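(* Let $m$ be a positive integer, let $G$ be an $m$-boundedly generated group, and let $L \leq G$ be a finite index subgroup. Then there exists a finite index subgroup $U \leq L$ which can be generated by $m$ elements.
   Context: For a positive integer $m$, a group $G$ is called $m$-boundedly generated if there exist $g_1, \dots, g_m \in G$ such that $G = \langle g_1 \rangle \cdots \langle g_m \rangle$ as sets, i.e. every element of $G$ can be written as $g_1^{a_1} \cdots g_m^{a_m}$ for some integers $a_1, \dots, a_m$. *)

(* Defs.v *)
From mathcomp Require Import all_boot ssralg ssrint classical_sets cardinality.

Set Implicit Arguments.
Unset Strict Implicit.
Unset Printing Implicit Defensive.

Local Open Scope classical_set_scope.
Local Open Scope group_scope.

Section BoundedGeneration.
Variable G : groupType.
Implicit Types (x g : G) (S H K : set G).

(* [Negz n] is the integer - n.+1. *)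
Definition expgz x (a : int) : G :=
  match a with Posz n => x ^+ n | Negz n => x ^- n.+1 end.

Definition is_subgroup H : Prop := group_closed [in H].

Definition subgroup_generated S : set G := smallest is_subgroup S.

(* The generators are not required to be distinct, so this reads
   "by at most m elements" in terms of the cardinality of a generating set. *)
Definition generated_by (m : nat) H : Prop :=
  exists u : 'I_m -> G, H = subgroup_generated (range u).

Definition left_coset x H : set G := [set x * h | h in H].

(* |K : H| is finite; meant for subgroups H `<=` K. *)
Definition finite_index H K : Prop :=
  finite_set [set left_coset x H | x in K].

End BoundedGeneration.

(* The iterated product of a non-commutative group is taken in the order
   i = 0, 1, ..., m - 1. *)
Definition boundedly_generated (m : nat) (G : groupType) : Prop :=
  exists g : 'I_m -> G, forall x : G, exists a : 'I_m -> int,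
    x = \prod_(i < m) expgz (g i) (a i).

(* Main.v *)
Require Import Defs.
From mathcomp Require Import all_boot ssralg ssrint classical_sets cardinality.
From mathcomp Require Import boolp.

Local Open Scope classical_set_scope.

(** Let [k > 0] be such that all conjugates of the [k]-th powers of the
    generators [g_i] lie in [L]. Writing every exponent as [r + k b] with [r] in
    a finite set and moving the factors [g_i ^ r] to the left turns [G] into a
    finite union of sets [t <h_1> ... <h_m>], with [h_i] a conjugate of
    [g_i ^ k]. So finitely many left cosets of [m]-generated subgroups of [L]
    cover [G], and by B. H. Neumann's lemma one of these subgroups has finite
    index. *)

Section Subgroups.
Local Open Scope group_scope.
Set Implicit Arguments.
Unset Strict Implicit.
Variable G : groupType.
Implicit Types (x y g : G) (H S : set G).

Lemma is_subgroupP H :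
  is_subgroup H <-> H 1 /\ forall x y, H x -> H y -> H (x * y^-1).
Proof.
split=> [[/set_mem H1 Hdiv]|[H1 Hdiv]]; split=> //; last 2 first.
- exact: mem_set.
- by move=> x y /set_mem Hx /set_mem Hy; apply/mem_set/Hdiv.
- by move=> x y /mem_set Hx /mem_set Hy; apply/set_mem/Hdiv.
Qed.

Lemma subgroup1 H : is_subgroup H -> H 1.
Proof. by case/is_subgroupP. Qed.

Lemma subgroupV H x : is_subgroup H -> H x -> H x^-1.
Proof. by move=> /group_closedV HV /mem_set /HV /set_mem. Qed.

Lemma subgroupM H x y : is_subgroup H -> H x -> H y -> H (x * y).
Proof.
by move=> /group_closedM HM /mem_set Hx /mem_set Hy; apply/set_mem/HM.
Qed.

Lemma subgroupX H x n : is_subgroup H -> H x -> H (x ^+ n).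
Proof.
move=> sgH Hx; elim: n => [|n IHn]; first exact: subgroup1.
by rewrite expgS; apply: subgroupM.
Qed.

Lemma subgroup_expgz H x a : is_subgroup H -> H x -> H (expgz x a).
Proof.
by case: a => n sgH Hx; last apply: subgroupV => //; apply: subgroupX.
Qed.

Lemma subgroup_generatedP S : is_subgroup (subgroup_generated S).
Proof.
apply/is_subgroupP; split=> [H [sgH _]|x y Sx Sy H [sgH sSH]].
  exact: subgroup1.
by apply: subgroupM (subgroupV sgH _) => //; [apply: Sx|apply: Sy].
Qed.

Lemma left_cosetP x H y : left_coset x H y <-> H (x^-1 * y).
Proof.
split=> [[h Hh <-]|Hxy]; first by rewrite mulKg.
by exists (x^-1 * y); rewrite ?mulVKg.
Qed.

Lemma left_coset_eq x y H :
  is_subgroup H -> H (x^-1 * y) -> left_coset x H = left_coset y H.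
Proof.
move=> sgH Hxy; apply/seteqP; split=> z /left_cosetP Hz; apply/left_cosetP.
  rewrite -[z](mulVKg x) mulgA -[X in X * _]invgK invgM invgK.
  by apply: subgroupM => //; apply: subgroupV.
by rewrite -[z](mulVKg y) mulgA; apply: subgroupM.
Qed.

Lemma finite_index_sub H K : finite_index H setT -> finite_index H K.
Proof. by apply: sub_finite_set => _ [x _ <-]; exists x. Qed.

Lemma finite_index_cover H (s : seq G) : is_subgroup H ->
  (forall x, exists2 t, t \in s & left_coset t H x) -> finite_index H setT.
Proof.
move=> sgH cover_s.
apply: sub_finite_set (finite_image (left_coset (G:=G) ^~ H) (finite_seq s)).
move=> _ [x _ <-]; have [t s_t /left_cosetP Htx] := cover_s x.
by exists t => //; apply: left_coset_eq.
Qed.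

(* B. H. Neumann: if the cosets of [H j] do not suffice, a coset [x H j] is
   covered by cosets of the other subgroups, hence so are all the cosets of
   [H j], which can be discarded. *)
Lemma finite_coset_cover (I : eqType) (H : I -> set G) (J : seq I)
    (s : seq (G * I)) :
  (forall i, is_subgroup (H i)) ->
  (forall x, exists p, [/\ p \in s, p.2 \in J & left_coset p.1 (H p.2) x]) ->
  exists2 i, i \in J & finite_index (H i) setT.
Proof.
move=> sgH; elim: J s => [|j J IHJ] s cover_s; first by have [? []] := cover_s 1.
pose T : seq G := [seq p.1 | p <- s & p.2 == j].
have [coverT|] := pselect (forall x, exists2 t, t \in T & left_coset t (H j) x).
  by exists j; [rewrite mem_head|apply: finite_index_cover coverT].
move=> /existsNP[x xT].
(* Left translation by [p.1 * x^-1] carries the coset of [x] modulo [H j] onto that of [p.1], and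
   the cosets covering the former to cosets of the same subgroups covering the latter. *)
have [|i Ji fiH] := IHJ (s ++ [seq (p.1 * x^-1 * q.1, q.2) | p <- s, q <- s]).
  move=> y; have [p [s_p]] := cover_s y.
  rewrite in_cons; case: eqP => [pj _|_ /= Jp py]; last first.
    by exists p; rewrite mem_cat s_p.
  rewrite pj => /left_cosetP Hpy.
  have [q [s_q]] := cover_s (x * (p.1^-1 * y)).
  rewrite in_cons; case: eqP => [qj _|_ /= Jq] /left_cosetP Hq.
    (* A coset of [H j] meeting the coset of [x] contains [x], against the choice of [x]. *)
    case: xT; exists q.1; first by apply: map_f; rewrite mem_filter qj eqxx.
    apply/left_cosetP; rewrite qj in Hq.
    rewrite -[x](mulgK (p.1^-1 * y)) [X in H j X]mulgA.
    exact: subgroupM (subgroupV _ _).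
  exists (p.1 * x^-1 * q.1, q.2); split=> //.
    by rewrite mem_cat; apply/orP; right; apply/allpairsP; exists (p, q).
  by apply/left_cosetP; rewrite /= !invgM invgK -!mulgA.
by exists i; rewrite // in_cons Ji orbT.
Qed.

(** Pigeonhole: with [N] cosets in all, two of the cosets of [g ^+ n * x] for [n] from 0 to [N]
    coincide. The difference of their exponents is positive and at most [N], so it divides [N]!, a
    choice independent of [g] and [x]. *)
Lemma finite_index_expg_conj H : is_subgroup H -> finite_index H setT ->
  exists2 k, (0 < k)%N & forall g x, H ((g ^+ k) ^ x).
Proof.
move=> sgH /finite_seqP[s cosets_s].
exists (size s)`!; first exact: fact_gt0.
move=> g x; pose c n := left_coset (g ^+ n * x) H.
have: ~~ uniq (mkseq c (size s).+1).
  apply/negP => /(@uniq_leq_size _ _ s)leq_s.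
  suff: ((size s).+1 <= size s)%N by rewrite ltnn.
  rewrite -[X in (X <= _)%N](size_mkseq c); apply: leq_s => C /mapP[n _ ->].
  have : [set left_coset y H | y in setT] (c n) by exists (g ^+ n * x).
  by rewrite cosets_s.
move=> /(uniqPn set0)[i [j]]; rewrite size_mkseq => -[ltij ltjs].
rewrite !nth_mkseq //; last exact: ltn_trans ltjs.
move=> cij; have /left_cosetP : c i (g ^+ j * x).
  by rewrite cij; exists 1; rewrite ?mulg1 //; apply: subgroup1.
rewrite -(subnKC (ltnW ltij)) expgnDr invgM -!mulgA mulKg -conjgE => Hji.
have /dvdnP[q ->] : (j - i %| (size s)`!)%N.
  by rewrite dvdn_fact // subn_gt0 ltij; apply: leq_trans (leq_subr _ _) _.
by rewrite mulnC expgnA conjXg; apply: subgroupX.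
Qed.

Lemma expgz_conj g x a : (expgz g a) ^ x = expgz (g ^ x) a.
Proof. by case: a => n; rewrite /= ?conjVg conjXg. Qed.

Lemma expgz_residues k g : (0 < k)%N ->
  exists s : seq G, forall a, exists2 t, t \in s &
    exists b, expgz g a = t * expgz (g ^+ k) b.
Proof.
move=> k_gt0; pose f n := g ^+ n; pose f' n := g ^- n.
(* Negative exponents are divided by absolute value, so their remainders are negative too. *)
exists (map f (iota 0 k) ++ map f' (iota 0 k)).
have lt_iota n : n %% k \in iota 0 k by rewrite mem_iota ltn_mod.
case=> n /=.
  exists (f (n %% k)%N); first by rewrite mem_cat map_f.
  by exists (Posz (n %/ k)%N); rewrite /= -expgnA -expgnDr mulnC addnC -divn_eq.
exists (f' (n.+1 %% k)%N); first by rewrite mem_cat orbC map_f.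
have -> : g ^- n.+1 = f' (n.+1 %% k)%N * (g ^+ k) ^- (n.+1 %/ k).
  by rewrite -invgM -expgnA -expgnDr mulnC -divn_eq.
(* [Negz] cannot encode a zero quotient. *)
case: (n.+1 %/ k)%N => [|q]; first by exists (Posz 0); rewrite /= invg1.
by exists (Negz q).
Qed.

(** Induction on [r]: if the product over the tail is [p.1 * u] with [u] generated by [p.2], then
    the new factor [t * h], with [h] a power of [g i ^+ k], gives [t * h * p.1 * u = (t * p.1) * (h
    ^ p.1 * u)]. Closure of [C] under conjugation keeps the new generator in [C]. *)
Lemma prod_expgz_cover (C : set G) (I : Type) (r : seq I) (g : I -> G) k :
  (0 < k)%N -> (forall x, C (x ^+ k)) -> (forall x y, C x -> C (x ^ y)) ->
  exists s : seq (G * seq G),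
    (forall p, p \in s -> size p.2 = size r /\ [set` p.2] `<=` C) /\
    forall a : I -> int, exists2 p, p \in s &
      left_coset p.1 (subgroup_generated [set` p.2])
        (\prod_(i <- r) expgz (g i) (a i)).
Proof.
move=> k_gt0 Ck CJ; elim: r => [|i r [s [s_ok cover_s]]].
  exists [:: (1, [::])]; split=> [p|a]; first by rewrite inE => /eqP ->.
  exists (1, [::]); rewrite ?mem_head // big_nil; apply/left_cosetP.
  by rewrite /= mulVg; exact: subgroup1 (subgroup_generatedP _).
have [ts cover_ts] := expgz_residues (g i) k_gt0.
exists [seq (t * p.1, ((g i) ^+ k) ^ p.1 :: p.2) | t <- ts, p <- s].
split=> [_ /allpairsP[[t p] /= [_ /s_ok[size_p Cp] ->]]|a].
  split=> [|x /=]; first by rewrite /= size_p.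
  by rewrite in_cons => /orP[/eqP -> |]; [apply/CJ/Ck|apply: Cp].
have [p s_p /left_cosetP gen_p] := cover_s a.
have [t ts_t [b ab]] := cover_ts (a i).
exists (t * p.1, ((g i) ^+ k) ^ p.1 :: p.2).
  by apply/allpairsP; exists (t, p).
apply/left_cosetP; rewrite big_cons ab /= -[X in _ * (_ * X)](mulVKg p.1).
rewrite invgM -!mulgA mulKg mulgA mulgA -(mulgA _ _ p.1) -conjgE expgz_conj.
have sgU := subgroup_generatedP [set` ((g i) ^+ k) ^ p.1 :: p.2].
apply: (subgroupM sgU).
  apply: (subgroup_expgz _ sgU).
  by apply: sub_gen_smallest; rewrite /= mem_head.
apply: sub_smallest2r gen_p => // x /= p_x.
by rewrite in_cons p_x orbT.
Qed.

Lemma generated_by_seq (h : seq G) :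
  generated_by (size h) (subgroup_generated [set` h]).
Proof.
exists (fun i => nth 1 h i); congr subgroup_generated; apply/seteqP.
split=> [x /= /(nthP 1)[i lt_i <-]|_ [i _ <-]]; last exact: mem_nth.
by exists (Ordinal lt_i).
Qed.

End Subgroups.

Theorem theorem1p1 (m : nat) (m_gt0 : (0 < m)%N) (G : groupType)
    (G_bg : boundedly_generated m G)
    (L : set G) (L_subgroup : is_subgroup L) (L_fin : finite_index L [set: G]) :
  exists U : set G,
    [/\ is_subgroup U, U `<=` L, finite_index U L & generated_by m U].
Proof.
have [g gen_g] := G_bg.
have [k k_gt0 Lk] := finite_index_expg_conj L_subgroup L_fin.
(* This is the normal core of [L]: unlike [L], it is always stable under conjugation. *)
pose C := [set x : G | forall y, L (x ^ y)%g].
have CJ x y : C x -> C (x ^ y)%g by move=> Cx z; rewrite -conjgM; apply: Cx.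
have [s [s_ok cover_s]] :=
  prod_expgz_cover (index_enum 'I_m) g k_gt0 (fun x => Lk x) CJ.
pose U (h : seq G) := subgroup_generated [set` h].
(* Each subgroup is indexed by its own list of generators, so the pairs in [s] already have the form
   required by the covering lemma. *)
have [x|h /mapP[p /s_ok[size_p Cp] ->] fiU] :=
  finite_coset_cover (H := U) (J := [seq p.2 | p <- s]) (s := s)
    (fun h => subgroup_generatedP _).
  have [a ->] := gen_g x; have [p s_p px] := cover_s a.
  by exists p; rewrite map_f.
exists (U p.2); split.
- exact: subgroup_generatedP.
- by apply: smallest_sub => // x /Cp /(_ 1%g); rewrite conjg1.
- exact: finite_index_sub.
- have <- : size p.2 = m by rewrite size_p /index_enum -enumT size_enum_ord.
  exact: generated_by_seq.
Qed.
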